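(* Let $P\in\mathbb{R}^{n\times n}$ be symmetric and positive semidefinite, $q\in\mathbb{R}^n$, $H\in\mathbb{R}^{m\times n}$, $g\in\mathbb{R}^m$, let $\mathbb{D}\subset\mathbb{R}^n$ be a nonempty closed convex set and $\mathbb{K}\subset\mathbb{R}^m$ a nonempty closed convex cone. Let $\alpha,\beta>0$ satisfy $\alpha(\|P\|+\beta\|H\|^2)<1$ and let $\rho\in(0,2)$. Let $\xi^1\in\mathbb{R}^n$, $\eta^1\in\mathbb{R}^m$ be arbitrary, and for $j=1,2,\ldots$ define recursively $$z^{j+1}=\pi_{\mathbb{D}}[\xi^j-\alpha(P\xi^j+q+H^\top\eta^j)],$$ $$w^{j+1}=\pi_{\mathbb{K}^\circ}[\eta^j+\beta(H(2z^{j+1}-\xi^j)-g)],$$ $$\xi^{j+1}=(1-\rho)\xi^j+\rho z^{j+1},\qquad \eta^{j+1}=(1-\rho)\eta^j+\rho w^{j+1}.$$ Then there exist $\overline{z}\in\mathrm{rec}\,\mathbb{D}$ and $\overline{w}\in\mathbb{K}^\circ$ such that $$\lim_{j\to\infty}(z^j-z^{j-1})=\overline{z},\qquad \lim_{j\to\infty}(w^j-w^{j-1})=\overline{w},$$ and the following conditions hold: $$\inf_{z\in\mathbb{D}}\langle Hz-g,\overline{w}\rangle=\sup_{y\in\mathbb{K}}\langle y,\overline{w}\rangle+\frac{1}{\rho\beta}\|\overline{w}\|^2,$$ $$H\overline{z}\in\mathbb{K},\qquad P\overline{z}=0,\qquad \langle q,\overline{z}\rangle=-\frac{1}{\rho\alpha}\|\overline{z}\|^2.$$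 Furthermore, if $\|\overline{w}\|=\|\overline{z}\|=0$, then $$\lim_{j\to\infty}d(Hz^j-g\,|\,N_{\mathbb{K}^\circ}(w^j))=0,\qquad \lim_{j\to\infty}d(-Pz^j-q-H^\top w^j\,|\,N_{\mathbb{D}}(z^j))=0.$$
   Context: $\langle\cdot,\cdot\rangle$ and $\|\cdot\|$ are the standard inner product and $\ell_2$-norm for vectors; for a matrix, $\|\cdot\|$ denotes its largest singular value. A set $\mathbb{K}\subseteq\mathbb{R}^m$ is a convex cone if it is convex and $\alpha w\in\mathbb{K}$ for all $w\in\mathbb{K}$ and all real $\alpha\ge 0$. For a nonempty closed convex set $\mathbb{D}\subseteq\mathbb{R}^n$ and $z\in\mathbb{R}^n$: the point-to-set distance is $d(z\,|\,\mathbb{D})=\min_{z'\in\mathbb{D}}\|z-z'\|$; the projection is $\pi_{\mathbb{D}}[z]=\mathrm{argmin}_{z'\in\mathbb{D}}\|z-z'\|$; the normal cone is $N_{\mathbb{D}}(z)=\{y\in\mathbb{R}^n : \langle y,z'-z\rangle\le 0\ \forall z'\in\mathbb{D}\}$; the recession cone is $\mathrm{rec}\,\mathbb{D}=\{y\in\mathbb{R}^n : y+z\in\mathbb{D}\ \forall z\in\mathbb{D}\}$. The polar cone of $\mathbb{K}$ is $\mathbb{K}^\circ=\{w\in\mathbb{R}^m : \langle w,y\rangle\le 0\ \forall y\in\mathbb{K}\}$. The same notation applies with $\mathbb{D}$ replaced by other nonempty closed convex sets such as $\mathbb{K}^\circ$, $N_{\mathbb{D}}(z^j)$ and $N_{\mathbb{K}^\circ}(w^j)$.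 The iterates $z^j,w^j$ are defined for $j\ge 2$. *)

(* Defs.v *)
From HB Require Import structures.
From mathcomp Require Import all_boot all_order all_algebra.
From mathcomp Require Import all_classical all_reals all_analysis.

Set Implicit Arguments.
Unset Strict Implicit.
Unset Printing Implicit Defensive.

Import Order.TTheory GRing.Theory Num.Theory.
Import numFieldNormedType.Exports.

Local Open Scope classical_set_scope.
Local Open Scope ring_scope.

(** R^n is ['cV[R]_n] for [R : realType].  The library norm [`|x|] on matrices
    is the max-norm, so the Euclidean norm is introduced separately; the library
    topology on ['cV[R]_n] (used for [closed] and for limits) is the usual one. *)

Definition dotv (R : realType) (n : nat) (u v : 'cV[R]_n) : R :=
  \sum_(i < n) u i 0 * v i 0.

Definition l2norm (R : realType) (n : nat) (u : 'cV[R]_n) : R :=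
  Num.sqrt (dotv u u).

(** Largest singular value.  The singular values of [A] are the square roots of
    the eigenvalues of [A^T A], a finite set of nonnegative reals; it is
    nonempty unless [n = 0], in which case [sup set0 = 0]. *)
Definition sigma_max (R : realType) (m n : nat) (A : 'M[R]_(m, n)) : R :=
  sup [set Num.sqrt l | l in [set l : R | eigenvalue (A^T *m A) l]].

Definition symmetric_mx (R : realType) (n : nat) (P : 'M[R]_n) : Prop :=
  P^T = P.

Definition psd_mx (R : realType) (n : nat) (P : 'M[R]_n) : Prop :=
  forall x : 'cV[R]_n, 0 <= dotv x (P *m x).

Definition convex_cone (R : realType) (m : nat) (K : set 'cV[R]_m) : Prop :=
  convex_set K /\ forall (a : R) (w : 'cV[R]_m), 0 <= a -> K w -> K (a *: w).

(** The minimum defining the distance is attained when [D] is nonempty and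
    closed, hence equals this infimum. *)
Definition dist_to (R : realType) (n : nat) (z : 'cV[R]_n) (D : set 'cV[R]_n) : R :=
  inf [set l2norm (z - z') | z' in D].

(** The argmin is unique when [D] is nonempty, closed and convex; the default
    value [0] only matters when no minimizer exists. *)
Definition proj_on (R : realType) (n : nat) (D : set 'cV[R]_n) (z : 'cV[R]_n) :
    'cV[R]_n :=
  xget 0 [set p | D p /\ forall z', D z' -> l2norm (z - p) <= l2norm (z - z')].

(** [z] is not required to lie in [D]. *)
Definition normal_cone (R : realType) (n : nat) (D : set 'cV[R]_n)
    (z : 'cV[R]_n) : set 'cV[R]_n :=
  [set y | forall z', D z' -> dotv y (z' - z) <= 0].

Definition rec_cone (R : realType) (n : nat) (D : set 'cV[R]_n) : set 'cV[R]_n :=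
  [set y | forall z, D z -> D (y + z)].

Definition polar_cone (R : realType) (m : nat) (K : set 'cV[R]_m) : set 'cV[R]_m :=
  [set w | forall y, K y -> dotv w y <= 0].

(* Main.v *)
(** Let [s = (xi, eta)] and [p = (z, w)].  In the metric
    [pd_form (x, y) (x, y) = |x|^2 / alpha - <P x, x> - 2 <H x, y> + |y|^2 / beta],
    which the step size condition makes positive definite, [s |-> p] is firmly
    nonexpansive, so [s |-> s + rho (p - s)] is averaged.  For an averaged map
    the steps [d_j = s_(j+1) - s_j] converge: with [L = lim |d_j|] one has
    [|s_(i+k) - s_i| >= k L], and the vectors
    [2 / N^2 * sum_(k <= N) (s_(i+k) - s_i)] have norm at most [(1 + 1/N) |d_i|],
    scalar product at least [L^2] with [d_i], and become independent of [i] as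
    [N -> oo]; hence the [d_i] form a Cauchy sequence.  The limit [(zbar, wbar)]
    is also the limit of [p_(j+1) - p_j] and of [p_j / j].  The remaining
    conditions come from the inclusions [y_j \in N_D(z_(j+1))], [u_j \in K] and
    [<u_j, w_(j+1)> = 0] satisfied by the residuals of the two projections,
    divided by [j] or [j^2]. *)

Require Import Defs.
From mathcomp Require Import all_boot all_order all_algebra.
From mathcomp Require Import all_classical all_reals all_analysis.
From mathcomp Require Import zify ring lra.
Import Order.TTheory GRing.Theory Num.Theory.
Import numFieldNormedType.Exports.

Set Implicit Arguments.
Unset Strict Implicit.
Unset Printing Implicit Defensive.

Local Open Scope classical_set_scope.
Local Open Scope ring_scope.

(** * Semi-inner products and their seminorms *)

(** Degenerate forms must qualify: besides the metric of the iteration, [<P x, y>] and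
    [l <x, y> - <A x, A y>] are treated as instances. *)
Definition semi_inner (R : realType) (V : lmodType R) (B : V -> V -> R) : Prop :=
  [/\ forall x y, B x y = B y x, forall x y z, B (x + y) z = B x z + B y z,
      forall a x y, B (a *: x) y = a * B x y & forall x, 0 <= B x x].

Section SemiInner.
Variables (R : realType) (V : lmodType R) (B : V -> V -> R).
Hypothesis siB : semi_inner B.

Lemma siC x y : B x y = B y x. Proof. by case: siB. Qed.

Lemma siDl x y z : B (x + y) z = B x z + B y z. Proof. by case: siB. Qed.

Lemma siZl a x y : B (a *: x) y = a * B x y. Proof. by case: siB. Qed.

Lemma si_ge0 x : 0 <= B x x. Proof. by case: siB. Qed.

Lemma siDr x y z : B z (x + y) = B z x + B z y.
Proof. by rewrite siC siDl !(siC z). Qed.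

Lemma siZr a x y : B y (a *: x) = a * B y x.
Proof. by rewrite siC siZl (siC x). Qed.

Lemma siNl x y : B (- x) y = - B x y.
Proof. by rewrite -scaleN1r siZl mulN1r. Qed.

Lemma siNr x y : B y (- x) = - B y x.
Proof. by rewrite siC siNl siC. Qed.

Lemma si0l y : B 0 y = 0.
Proof. by rewrite -(scale0r y) siZl mul0r. Qed.

Definition siE := (siDl, siDr, siZl, siZr, siNl, siNr).

Lemma si_sqrB x y : B (x - y) (x - y) = B x x - 2 * B x y + B y y.
Proof. by rewrite !siE (siC y x); ring. Qed.

Lemma si_cauchy_schwarz x y : B x y ^+ 2 <= B x x * B y y.
Proof.
have [y0|y0] := eqVneq (B y y) 0; last first.
  have y_gt0 : 0 < B y y by rewrite lt_def y0 si_ge0.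
  have := si_ge0 (B y y *: x - B x y *: y).
  rewrite !siE (siC y x) => h.
  by rewrite -subr_ge0 -(pmulr_rge0 _ y_gt0); apply: le_trans h _; nra.
rewrite y0 mulr0; have [->|b0] := eqVneq (B x y) 0; first by rewrite expr0n.
(* When [B y y = 0], the form at [x + t y] is affine in [t]; this [t] gives it the value -1. *)
have := si_ge0 (x + (- (B x x + 1) / (2 * B x y)) *: y).
rewrite !siE (siC y x) y0.
rewrite (_ : _ + _ = -1); first by rewrite oppr_ge0 ler10.
by field.
Qed.

Definition snorm x : R := Num.sqrt (B x x).

Lemma snorm_ge0 x : 0 <= snorm x. Proof. exact: sqrtr_ge0. Qed.

Lemma sqr_snorm x : snorm x ^+ 2 = B x x.
Proof. by rewrite sqr_sqrtr // si_ge0. Qed.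

Lemma si_le_snorm x y : B x y <= snorm x * snorm y.
Proof.
apply: le_trans (ler_norm _) _.
rewrite -(@ler_pXn2r _ 2) ?nnegrE ?mulr_ge0 ?snorm_ge0 //.
by rewrite exprMn !sqr_snorm real_normK ?num_real // si_cauchy_schwarz.
Qed.

Lemma snorm_triangle x y : snorm (x + y) <= snorm x + snorm y.
Proof.
rewrite -(@ler_pXn2r _ 2) ?nnegrE ?addr_ge0 ?snorm_ge0 //.
rewrite sqrrD !sqr_snorm !siE (siC y x).
have := si_le_snorm x y; lra.
Qed.

Lemma snormZ a x : snorm (a *: x) = `|a| * snorm x.
Proof. by rewrite /snorm !siE mulrA -expr2 sqrtrM ?sqr_ge0 // sqrtr_sqr. Qed.

Lemma snorm0 : snorm 0 = 0.
Proof. by rewrite /snorm si0l sqrtr0. Qed.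

Lemma snormB x y : snorm (x - y) = snorm (y - x).
Proof. by rewrite -(opprB y) -(scaleN1r (y - x)) snormZ normrN1 mul1r. Qed.

Lemma snorm_sum n (F : nat -> V) (f : nat -> R) :
  (forall k, (k < n)%N -> snorm (F k) <= f k) ->
  snorm (\sum_(k < n) F k) <= \sum_(k < n) f k.
Proof.
elim: n => [|n IHn] Ff; first by rewrite !big_ord0 snorm0.
rewrite !big_ord_recr /=; apply: le_trans (snorm_triangle _ _) _.
by apply: lerD; [apply: IHn => k kn; apply: Ff; exact: ltnW | exact: Ff].
Qed.

End SemiInner.

(** * Convergence of the steps of an averaged orbit *)

Section AveragedOrbit.
Variables (R : realType) (V : lmodType R) (B : V -> V -> R).
Hypothesis siB : semi_inner B.
Variables (s : nat -> V) (c : R).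
Hypothesis c_gt0 : 0 < c.
Local Notation N := (snorm B).
Let d j := s j.+1 - s j.
Hypothesis s_averaged : forall j k,
  B (s j.+1 - s k.+1) (s j.+1 - s k.+1) <=
  B (s j - s k) (s j - s k) - c * B (d j - d k) (d j - d k).

Lemma orbit_nonexpansive j k i : N (s (j + i)%N - s (k + i)%N) <= N (s j - s k).
Proof.
elim: i => [|i]; first by rewrite !addn0.
apply: le_trans; rewrite !addnS ler_sqrt ?si_ge0 //.
apply: le_trans (s_averaged _ _) _.
by rewrite gerBl mulr_ge0 ?(ltW c_gt0) ?si_ge0.
Qed.

Lemma step_nonincreasing i j : (i <= j)%N -> N (d j) <= N (d i).
Proof. by move=> /subnKC <-; rewrite /d -addSn orbit_nonexpansive. Qed.

Lemma orbit_displacement_le i k : N (s (i + k)%N - s i) <= k%:R * N (d i).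
Proof.
elim: k => [|k IHk]; first by rewrite addn0 subrr mul0r snorm0.
rewrite addnS -[X in N X](subrKA (s (i + k)%N)).
apply: le_trans (snorm_triangle siB _ _) _.
rewrite -natr1 mulrDl mul1r addrC lerD // /d.
by apply: step_nonincreasing; exact: leq_addr.
Qed.

(** The step norms are nonincreasing, so this infimum is also their limit. *)
Let L := inf (range (fun j => N (d j))).

Let L_le j : L <= N (d j).
Proof.
by apply: ge_inf; [exists 0 => _ [i _ <-]; exact: snorm_ge0 | exists j].
Qed.

Let L_ge0 : 0 <= L.
Proof.
by apply: lb_le_inf => [|_ [i _ <-]]; [exists (N (d 0)), 0 | exact: snorm_ge0].
Qed.

Let sqr_d_cvg (e : R) : 0 < e ->
  exists J, forall j, (J <= j)%N -> B (d j) (d j) - L ^+ 2 <= e.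
Proof.
move=> e_gt0.
have hi : has_inf (range (fun j => N (d j))).
  by split; [exists (N (d 0)), 0 | exists 0 => _ [i _ <-]; exact: snorm_ge0].
have D_gt0 : 0 < 2 * L + 1 by have := L_ge0; lra.
(* Since [e' <= 1], [(L + e')^2 <= L^2 + e' (2 L + 1) <= L^2 + e]. *)
pose e' := Num.min 1 (e / (2 * L + 1)).
have e'_gt0 : 0 < e' by rewrite lt_min ltr01 divr_gt0.
have [_ [J _ <-] dJ] := inf_adherent e'_gt0 hi.
exists J => j Jj; rewrite -(sqr_snorm siB).
have h := step_nonincreasing Jj.
have e'1 : e' <= 1 by rewrite ge_min lexx.
have e'2 : e' * (2 * L + 1) <= e by rewrite -ler_pdivlMr // ge_min lexx orbT.
have := L_le j; have := snorm_ge0 B (d j); rewrite -/L in dJ; have := L_ge0; nra.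
Qed.

(** Averagedness gives [c |d_(l+1) - d_l|^2 <= |d_l|^2 - |d_(l+1)|^2], which is small for large [l].
    Far along the orbit, [k] consecutive steps thus almost coincide, and their sum has norm almost
    [k |d_j| >= k L]. Nonexpansiveness carries this bound back to the index [i]. *)
Lemma orbit_displacement_ge i k : k%:R * L <= N (s (i + k)%N - s i).
Proof.
apply/ler_addgt0Pr => e e_gt0.
(* The displacement over [k] steps will differ from [k d_j] by at most [k^2 eta]. *)
pose eta := e / (k ^ 2).+1%:R.
have eta_gt0 : 0 < eta by rewrite divr_gt0.
have [J dJ] := sqr_d_cvg (mulr_gt0 c_gt0 (exprn_gt0 2 eta_gt0)).
pose j := (i + J)%N.
have slow l : (J <= l)%N -> N (d l.+1 - d l) <= eta.
  move=> Jl; rewrite -(@ler_pXn2r _ 2) ?nnegrE ?snorm_ge0 ?(ltW eta_gt0) //.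
  rewrite (sqr_snorm siB) -(ler_pM2l c_gt0).
  have := s_averaged l.+1 l; rewrite -/(d l.+1) -/(d l).
  have := dJ l Jl; have := L_le l.+1; rewrite -[B (d l.+1) _](sqr_snorm siB).
  have := L_ge0; nra.
have drift r : N (d (j + r)%N - d j) <= r%:R * eta.
  elim: r => [|r IHr]; first by rewrite addn0 subrr mul0r snorm0.
  rewrite addnS -[X in N X](subrKA (d (j + r)%N)).
  apply: le_trans (snorm_triangle siB _ _) _.
  rewrite -natr1 mulrDl mul1r addrC lerD // slow //.
  by rewrite /j -addnA addnCA leq_addr.
have lin r : N (s (j + r)%N - s j - r%:R *: d j) <= (r ^ 2)%:R * eta.
  elim: r => [|r IHr]; first by rewrite addn0 subrr scale0r subr0 mul0r snorm0.
  have -> : s (j + r.+1)%N - s j - r.+1%:R *: d j =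
      (s (j + r)%N - s j - r%:R *: d j) + (d (j + r)%N - d j).
    rewrite addnS /d -natr1 scalerDl scale1r.
    rewrite opprD !addrA; congr (_ - _).
    by rewrite [RHS]addrC !addrA addNr add0r [RHS]addrC !addrA.
  apply: le_trans (snorm_triangle siB _ _) _.
  apply: le_trans (lerD IHr (drift r)) _; rewrite -mulrDl -natrD ler_pM2r //.
  by rewrite ler_nat; lia.
have kd : k%:R * L <= N (k%:R *: d j).
  by rewrite (snormZ siB) ger0_norm // ler_wpM2l.
apply: le_trans kd _; rewrite -[X in N X](subrK (s (j + k)%N - s j)).
apply: le_trans (snorm_triangle siB _ _) _; rewrite addrC lerD //.
  have := orbit_nonexpansive (i + k) i J.
  by rewrite /j (addnAC i).
rewrite (snormB siB); apply: le_trans (lin k) _.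
rewrite /eta mulrCA ger_pMr // ler_pdivrMr // mul1r ler_nat.
exact: leqnSn.
Qed.

(* Nonexpansiveness applied to the pairs [(s_(i+k), s_i)] telescopes in [k]. *)
Lemma orbit_mean_bound i n :
  n%:R ^+ 2 * L ^+ 2 <= 2 * B (\sum_(k < n) (s (i + k.+1)%N - s i)) (d i).
Proof.
apply: le_trans (_ : B (s (i + n)%N - s i) (s (i + n)%N - s i) <= _).
  rewrite -exprMn -(sqr_snorm siB) ler_pXn2r ?nnegrE ?snorm_ge0 ?mulr_ge0 //.
  exact: orbit_displacement_ge.
elim: n => [|n IHn]; first by rewrite addn0 subrr big_ord0 !(si0l siB) mulr0.
rewrite big_ord_recr /= [X in 2 * X](siDl siB) mulrDr [leRHS]addrC -lerBlDl.
apply: le_trans IHn; rewrite lerBlDl.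
have := s_averaged (i + n)%N i; rewrite -addnS.
have -> : s (i + n.+1)%N - s i.+1 = (s (i + n.+1)%N - s i) - d i.
  by rewrite /d opprB addrA subrK.
have := mulr_ge0 (ltW c_gt0) (si_ge0 siB (d (i + n)%N - d i)).
have := si_ge0 siB (d i).
move: (d i) (d (i + n)%N) (s (i + n.+1)%N - s i) (s (i + n)%N - s i).
move=> d1 d2 x y d1_ge0 d_ge0; rewrite (si_sqrB siB x d1).
lra.
Qed.

(** If all steps were one vector [v], the sum would be [n (n + 1) / 2] times [v], and [U i n] would
    be [(1 + 1/n) v]. *)
Let U i n := (2 / n%:R ^+ 2) *: \sum_(k < n) (s (i + k.+1)%N - s i).

(** Expand the square, using [<U, d_i> >= L^2], [|U| <= (1 + 1/n) |d_i|] and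
    [(1 + 1/n)^2 <= 1 + 3/n]. *)
Let U_dist i n : (0 < n)%N ->
  B (d i - U i n) (d i - U i n) <=
  2 * (B (d i) (d i) - L ^+ 2) + 3 / n%:R * B (d i) (d i).
Proof.
move=> n_gt0; have nR : (0 : R) < n%:R by rewrite ltr0n.
have dU : L ^+ 2 <= B (U i n) (d i).
  rewrite /U (siZl siB) mulrAC ler_pdivlMr ?exprn_gt0 // mulrC.
  exact: orbit_mean_bound.
have Usq : B (U i n) (U i n) <= (1 + n%:R^-1) ^+ 2 * B (d i) (d i).
  rewrite -!(sqr_snorm siB) -exprMn.
  rewrite ler_pXn2r ?nnegrE ?snorm_ge0 ?mulr_ge0 ?snorm_ge0 ?addr_ge0 ?invr_ge0 //.
  rewrite /U (snormZ siB) ger0_norm ?divr_ge0 ?exprn_ge0 //.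
  have := @snorm_sum _ _ _ siB n (fun k => s (i + k.+1)%N - s i)
    (fun k => k.+1%:R * N (d i)) (fun k _ => orbit_displacement_le i k.+1).
  rewrite -mulr_suml => h.
  have -> : (1 + n%:R^-1) * N (d i) =
      2 / n%:R ^+ 2 * ((\sum_(k < n) k.+1%:R) * N (d i)).
    rewrite mulrA; congr (_ * _).
    have -> : \sum_(k < n) k.+1%:R = (n%:R * (n%:R + 1)) / 2 :> R.
      elim: (n) => [|p IHp]; first by rewrite big_ord0 !mul0r.
      by rewrite big_ord_recr /= IHp -natr1; field.
    by field; rewrite gt_eqF.
  by rewrite ler_pM2l ?divr_gt0 ?exprn_gt0.
have dd := si_ge0 siB (d i).
move: (d i) (U i n) dU Usq dd => x u dU Usq dd; rewrite (si_sqrB siB) (siC siB x u).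
have m1 : n%:R^-1 <= 1 :> R by rewrite invf_le1 // ler1n.
have m0 : 0 < n%:R^-1 :> R by rewrite invr_gt0.
move: (n%:R^-1) m1 m0 Usq => m m1 m0 Usq.
have : m * m * B x x <= m * B x x by rewrite ler_wpM2r // ger_pMr.
by move: Usq; rewrite sqrrD expr1n mul1r !mulrDl mul1r; lra.
Qed.

(** By nonexpansiveness each of the [n] summands of the difference has norm at most [2 |s_i - s_l|];
    the factor [2 / n^2] leaves [4 / n], and [16 / n^2 <= 16 / n]. *)
Let U_cauchy i l n : (0 < n)%N ->
  B (U i n - U l n) (U i n - U l n) <= 16 / n%:R * B (s i - s l) (s i - s l).
Proof.
move=> n_gt0; have nR : (0 : R) < n%:R by rewrite ltr0n.
have : N (U i n - U l n) <= 4 / n%:R * N (s i - s l).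
  rewrite /U -scalerBr -sumrB (snormZ siB) ger0_norm ?divr_ge0 ?exprn_ge0 //.
  have h k : (k < n)%N -> N (s (i + k.+1)%N - s i - (s (l + k.+1)%N - s l)) <=
      2 * N (s i - s l).
    move=> _; rewrite opprD opprK addrACA [- s i + _]addrC.
    apply: le_trans (snorm_triangle siB _ _) _.
    rewrite [N (s l - _)](snormB siB) mulr2n mulrDl mul1r lerD //.
    exact: orbit_nonexpansive.
  have := @snorm_sum _ _ _ siB n
    (fun k => s (i + k.+1)%N - s i - (s (l + k.+1)%N - s l))
    (fun _ => 2 * N (s i - s l)) h.
  rewrite sumr_const card_ord => h'.
  apply: le_trans (ler_wpM2l _ h') _; first by rewrite divr_ge0 ?exprn_ge0.
  by rewrite -mulr_natl le_eqVlt; apply/orP; left; apply/eqP; field; rewrite gt_eqF.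
rewrite -!(sqr_snorm siB) => h.
have a0 := snorm_ge0 B (U i n - U l n); have b0 := snorm_ge0 B (s i - s l).
have m1 : n%:R^-1 <= 1 :> R by rewrite invf_le1 // ler1n.
have m0 : 0 < n%:R^-1 :> R by rewrite invr_gt0.
apply: le_trans (_ : (4 / n%:R * N (s i - s l)) ^+ 2 <= _).
  by rewrite ler_pXn2r ?nnegrE ?mulr_ge0 ?invr_ge0.
rewrite exprMn ler_wpM2r ?sqr_ge0 // expr2; nra.
Qed.

(** Pass from [d_i] to [d_l] through [U i n] and [U l n]. Since [n] is chosen after [i] and [l], the
    terms of order [1/n] can be made small without any uniform control of [|s_i - s_l|]. *)
Lemma step_cauchy (e : R) : 0 < e ->
  exists J, forall i l, (J <= i)%N -> (J <= l)%N ->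
    B (d i - d l) (d i - d l) <= e.
Proof.
move=> e_gt0; have e12 : 0 < e / 12 by rewrite divr_gt0.
have [J dJ] := sqr_d_cvg e12; exists J => i l /dJ di /dJ dl.
apply/ler_addgt0Pr => r r_gt0.
(* The factors are 3 from the three-term inequality times 3 from [U_dist] or 16 from [U_cauchy];
   likewise the two excesses over [L^2] add up to [2 * 3 * 2 * e / 12 = e]. *)
pose C := 9 * B (d i) (d i) + 9 * B (d l) (d l) + 48 * B (s i - s l) (s i - s l).
have C0 : 0 <= C by rewrite !addr_ge0 ?mulr_ge0 ?si_ge0.
pose n := (Num.bound (C / r)).+1.
have nR : (0 : R) < n%:R by rewrite ltr0n.
have Cn : C / n%:R <= r.
  rewrite ler_pdivrMr // -ler_pdivrMl // mulrC.
  apply: le_trans (ltW (archi_boundP _)) _; first by rewrite divr_ge0 // ltW.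
  by rewrite ler_nat leqnSn.
have three (x y z : V) : B (x + y + z) (x + y + z) <=
    3 * B x x + 3 * B y y + 3 * B z z.
  have := si_ge0 siB (x - y); have := si_ge0 siB (x - z).
  have := si_ge0 siB (y - z); rewrite !(siE siB).
  rewrite (siC siB y x) (siC siB z x) (siC siB z y); lra.
have -> : d i - d l = (d i - U i n) + (U i n - U l n) + (U l n - d l).
  by rewrite subrKA subrKA.
apply: le_trans (three _ _ _) _.
have -> : B (U l n - d l) (U l n - d l) = B (d l - U l n) (d l - U l n).
  by rewrite -(opprB (d l)) !(siNl siB, siNr siB) opprK.
have := U_dist i (ltn0Sn _ : (0 < n)%N).
have := U_dist l (ltn0Sn _ : (0 < n)%N).
have := U_cauchy i l (ltn0Sn _ : (0 < n)%N).
move: Cn; rewrite /C -![_ / n%:R * _]mulrA ![n%:R^-1 * _]mulrC.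
rewrite !mulrDl; lra.
Qed.

End AveragedOrbit.

(** * Euclidean geometry and coordinatewise convergence *)

Section Euclid.
Variable R : realType.

Lemma dotv_semi_inner n : semi_inner (@dotv R n).
Proof.
split=> [x y|x y u|a x y|x].
- by apply: eq_bigr => i _; rewrite mulrC.
- by rewrite -big_split; apply: eq_bigr => i _; rewrite mxE mulrDl.
- by rewrite /dotv mulr_sumr; apply: eq_bigr => i _; rewrite mxE mulrA.
- by apply: sumr_ge0 => i _; rewrite -expr2 sqr_ge0.
Qed.

Lemma dotvC n (x y : 'cV[R]_n) : dotv x y = dotv y x.
Proof. exact: siC (@dotv_semi_inner n) x y. Qed.

Definition dotvE n := siE (@dotv_semi_inner n).

Lemma dotv_mulmx m n (A : 'M[R]_(m, n)) (x : 'cV[R]_n) (y : 'cV[R]_m) :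
  dotv (A *m x) y = dotv x (A^T *m y).
Proof.
suff E k (u v : 'cV[R]_k) : dotv u v = (u^T *m v) 0 0.
  by rewrite !E trmx_mul -mulmxA.
by rewrite mxE; apply: eq_bigr => i _; rewrite mxE.
Qed.

Lemma sqr_coord_le n (x : 'cV[R]_n) i : x i 0 ^+ 2 <= dotv x x.
Proof.
rewrite /dotv (bigD1 i) //= -expr2 lerDl; apply: sumr_ge0 => j _.
by rewrite -expr2 sqr_ge0.
Qed.

Lemma dotv_eq0 n (x : 'cV[R]_n) : dotv x x = 0 -> x = 0.
Proof.
move=> x0; apply/colP => i; rewrite mxE; apply/eqP.
by rewrite -sqrf_eq0 eq_le sqr_ge0 andbT -x0 sqr_coord_le.
Qed.

Lemma sqr_l2norm n (x : 'cV[R]_n) : l2norm x ^+ 2 = dotv x x.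
Proof. exact: sqr_snorm (@dotv_semi_inner n) x. Qed.

Lemma cvg_colP (T : Type) (F : set_system T) {FF : Filter F} n
    (u : T -> 'cV[R]_n) (l : 'cV[R]_n) :
  u @ F --> l <-> forall i, (fun j => u j i 0) @ F --> l i 0.
Proof.
split=> [ul i|ul].
  apply: (cvg_comp u (fun M : 'cV[R]_n => M i 0) ul).
  exact: coord_continuous.
apply/cvg_ballP => e e_gt0.
have : \forall j \near F, forall i, `|l i 0 - u j i 0| < e.
  apply: filter_forall => i.
  by have /cvgrPdist_lt/(_ _ e_gt0) := ul i.
apply: filterS => j uj; split=> // i k; rewrite (ord1 k).
exact: uj.
Qed.

Lemma cvg_dotv (T : Type) (F : set_system T) {FF : Filter F} n
    (u v : T -> 'cV[R]_n) a b :
  u @ F --> a -> v @ F --> b ->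
  (fun j => dotv (u j) (v j)) @ F --> dotv a b.
Proof.
move=> /cvg_colP ua /cvg_colP vb.
by apply: cvg_big => [|i _]; [exact: add_continuous | exact: cvgM].
Qed.

Lemma cvg_mulmx (T : Type) (F : set_system T) {FF : Filter F} m n (A : 'M[R]_(m, n))
    (u : T -> 'cV[R]_n) a :
  u @ F --> a -> (fun j => A *m u j) @ F --> A *m a.
Proof.
move=> /cvg_colP ua; apply/cvg_colP => i; rewrite mxE.
under eq_fun do rewrite mxE.
apply: cvg_big => [|k _]; first exact: add_continuous.
by apply: cvgM => //; exact: cvg_cst.
Qed.

(** Each coordinate is bounded by the Euclidean norm, hence is a real Cauchy sequence. *)
Lemma cauchy_dotv_cvg n (u : nat -> 'cV[R]_n) :
  (forall e : R, 0 < e -> exists J, forall i l, (J <= i)%N -> (J <= l)%N ->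
     dotv (u i - u l) (u i - u l) <= e) ->
  exists a : 'cV[R]_n, u @ \oo --> a.
Proof.
move=> uC.
suff h i : exists a : R, (fun j => u j i 0) @ \oo --> a.
  have [f fP] := choice h.
  by exists (\col_i f i); apply/cvg_colP => i; rewrite mxE.
apply/cvg_ex/cauchy_cvgP/cauchy_exP => e e_gt0.
have [J uJ] := uC (e ^+ 2 / 2) (divr_gt0 (exprn_gt0 2 e_gt0) (ltr0Sn R 1)).
exists (u J i 0); exists J => // j /= Jj.
rewrite /ball /= -(@ltr_pXn2r _ 2) ?nnegrE ?(ltW e_gt0) //.
rewrite real_normK ?num_real //.
have := sqr_coord_le (u J - u j) i; have := uJ J j (leqnn _) Jj.
have := exprn_gt0 2 e_gt0; rewrite !mxE; lra.
Qed.

(** * Projections onto closed convex sets *)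

Lemma convexP n (D : set 'cV[R]_n) : convex_set D -> forall x y (t : R),
  0 <= t -> t <= 1 -> D x -> D y -> D (x + t *: (y - x)).
Proof.
move=> Dc x y t t0 t1 Dx Dy.
have t01 : Itv.spec (@Itv.num_sem R) (Itv.Real `[0%Z, 1%Z]) t.
  by rewrite /Itv.spec /Itv.num_sem /= num_real /= in_itv /= t0.
have := Dc y x (Itv.mk t01) (mem_set Dy) (mem_set Dx).
rewrite inE -[X in D X]/(t *: y + (1 - t) *: x).
by rewrite scalerBl scale1r addrCA -scalerBr.
Qed.

Lemma closed_seq n (D : set 'cV[R]_n) (u : nat -> 'cV[R]_n) a :
  closed D -> (forall j, D (u j)) -> u @ \oo --> a -> D a.
Proof. by move=> Dcl Du; apply: closed_cvg => //; exact: nearW. Qed.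

(** A minimizing sequence is Cauchy by the parallelogram identity, because midpoints stay in [D];
    closedness puts its limit in [D]. *)
Lemma projection_exists n (D : set 'cV[R]_n) (x : 'cV[R]_n) :
  D !=set0 -> closed D -> convex_set D ->
  exists2 p, D p & forall y, D y -> dotv (x - p) (x - p) <= dotv (x - y) (x - y).
Proof.
move=> [y0 Dy0] Dcl Dcv; have si := @dotv_semi_inner n.
pose E := [set dotv (x - y) (x - y) | y in D].
have hE : has_inf E.
  split; first by exists (dotv (x - y0) (x - y0)), y0.
  by exists 0 => _ [y _ <-]; exact: (si_ge0 si).
have E_le y : D y -> inf E <= dotv (x - y) (x - y).
  by move=> Dy; apply: ge_inf; [case: hE | exists y].
have /choice[u uP] k : exists y, D y /\
    dotv (x - y) (x - y) < inf E + k.+1%:R^-1.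
  have [||_ [y Dy <-] ?] := @inf_adherent _ E (k.+1%:R^-1) => //.
  by exists y.
have [|p up] := @cauchy_dotv_cvg n u.
  (* Beyond this index the squared distances exceed their infimum by at most [e / 4], and the
     parallelogram identity turns two such excesses into [2 * (e / 4 + e / 4) = e]. *)
  move=> e e_gt0; exists (Num.bound (4 / e)) => i l Ji Jl.
  have inv k : (Num.bound (4 / e) <= k)%N -> k.+1%:R^-1 <= e / 4 :> R.
    move=> Jk; rewrite -(invf_div 4) lef_pV2 ?posrE ?divr_gt0 //.
    apply: le_trans (ltW (archi_boundP _)) _; first by rewrite divr_ge0 // ltW.
    by rewrite ler_nat ltnW.
  have [Di ui] := uP i; have [Dl ul] := uP l.
  have half0 : 0 <= 2^-1 :> R by lra.
  have half1 : 2^-1 <= 1 :> R by lra.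
  have := E_le _ (convexP Dcv half0 half1 Di Dl).
  have -> : x - (u i + 2^-1 *: (u l - u i)) =
      2^-1 *: ((x - u i) + (x - u l)).
    by apply/colP => k; rewrite !mxE; field.
  have -> : u i - u l = (x - u l) - (x - u i) by rewrite opprB [RHS]addrC subrKA.
  move: (x - u i) (x - u l) ui ul => a b ui ul.
  rewrite (si_sqrB si b a) !(dotvE n) (dotvC b a).
  have arith (aa bb ab i1 i2 f : R) : aa < f + i1 -> bb < f + i2 ->
      i2 <= e / 4 -> i1 <= e / 4 ->
      f <= 2^-1 * (2^-1 * (aa + ab) + 2^-1 * (ab + bb)) ->
      bb - 2 * ab + aa <= e by lra.
  exact: arith ui ul (inv l Jl) (inv i Ji).
exists p; first by apply: closed_seq Dcl _ up => k; case: (uP k).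
move=> y Dy; apply: le_trans (E_le y Dy).
have xu : (fun j => x - u j) @ \oo --> x - p by apply: cvgB => //; exact: cvg_cst.
have i0 : (fun k => inf E + k.+1%:R^-1) @ \oo --> inf E + (0 : R).
  by apply: cvgD; [exact: cvg_cst | exact: cvg_harmonic].
rewrite -[inf E]addr0; apply: ler_cvg_to (cvg_dotv xu xu) i0 _.
by apply: nearW => k; have [_ /ltW] := uP k.
Qed.

(** The variational inequality: were the product positive, a small move from the projection towards
    [y] would reduce the distance. *)
Lemma proj_onP n (D : set 'cV[R]_n) (x : 'cV[R]_n) :
  D !=set0 -> closed D -> convex_set D ->
  D (proj_on D x) /\
  forall y, D y -> dotv (x - proj_on D x) (y - proj_on D x) <= 0.
Proof.
move=> D0 Dcl Dcv; have si := @dotv_semi_inner n.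
have [p Dp pP] := projection_exists x D0 Dcl Dcv.
(* A minimizer exists, so [xget] returns one and not its default value. *)
have [] : [set p | D p /\ forall z', D z' -> l2norm (x - p) <= l2norm (x - z')]
    (proj_on D x).
  apply: (xgetPex 0); exists p; split=> // y Dy.
  by rewrite ler_sqrt ?(si_ge0 si) ?pP.
move: (proj_on D x) => {Dp pP}p Dp pP; split=> // y Dy.
rewrite leNgt; apply/negP => h.
have [b0|b_gt0] := eqVneq (dotv (y - p) (y - p)) 0.
  by move: h; rewrite (dotv_eq0 b0) dotvC (si0l si) ltxx.
have {}b_gt0 : 0 < dotv (y - p) (y - p) by rewrite lt_def b_gt0 (si_ge0 si).
(* The minimizer of the squared distance along the line, truncated so as to stay on the segment. *)
pose t := Num.min 1 (dotv (x - p) (y - p) / dotv (y - p) (y - p)).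
have t_gt0 : 0 < t by rewrite lt_min ltr01 divr_gt0.
have t1 : t <= 1 by rewrite ge_min lexx.
have tb : t * dotv (y - p) (y - p) <= dotv (x - p) (y - p).
  by rewrite -ler_pdivlMr // ge_min lexx orbT.
have := pP _ (convexP Dcv (ltW t_gt0) t1 Dp Dy).
rewrite ler_sqrt ?(si_ge0 si) // opprD addrA (si_sqrB si (x - p)).
move: (x - p) (y - p) tb h b_gt0 => a b tb h b_gt0.
rewrite !(dotvE n) => h2; nra.
Qed.

(** * Convex cones and polarity *)

Lemma cone0 n (K : set 'cV[R]_n) : K !=set0 -> convex_cone K -> K 0.
Proof. by move=> [k Kk] [_ KZ]; rewrite -(scale0r k); exact: KZ. Qed.

Lemma cone_add n (K : set 'cV[R]_n) x y :
  convex_cone K -> K x -> K y -> K (x + y).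
Proof.
move=> [Kc KZ] Kx Ky.
have half0 : 0 <= 2^-1 :> R by lra.
have half1 : 2^-1 <= 1 :> R by lra.
have := KZ 2 _ (ler0n _ _) (convexP Kc half0 half1 Kx Ky).
by congr (K _); apply/colP => i; rewrite !mxE; field.
Qed.

Lemma polar_closed n (K : set 'cV[R]_n) : closed (polar_cone K).
Proof.
rewrite (_ : polar_cone K = \bigcap_(y in K) [set w | dotv w y <= 0]).
  apply: closed_bigI => y Ky.
  rewrite (_ : [set w | _] = (fun w => dotv w y) @^-1` [set r | r <= 0]) //.
  apply: preimage_closed; last exact: closed_le.
  move=> w _; have h := cvg_dotv (@cvg_id _ (nbhs w)) (cvg_cst y).
  exact: h.
by apply/seteqP; split=> w.
Qed.

Lemma polar_convex n (K : set 'cV[R]_n) : convex_set (polar_cone K).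
Proof.
move=> x y t; rewrite !inE => Kx Ky k Kk.
rewrite -[X in dotv X k]/(t%:num *: x + (1 - t%:num) *: y).
rewrite !(dotvE n); have := Kx k Kk; have := Ky k Kk.
have t0 : 0 <= t%:num by []. have t1 : t%:num <= 1 by [].
nra.
Qed.

Lemma polar_cone_polar n (K : set 'cV[R]_n) : convex_cone (polar_cone K).
Proof.
split=> [|a w a0 Kw k Kk]; first exact: polar_convex.
by rewrite (dotvE n) mulr_ge0_le0 // Kw.
Qed.

(** With [p] the projection of [x] on [K], testing its inequality at [k + p] shows that [x - p] is
    polar, and testing at [0] that [<x - p, p> >= 0]. Hence [|x - p|^2 <= <x, x - p> <= 0]. *)
Lemma bipolar n (K : set 'cV[R]_n) x : K !=set0 -> closed K -> convex_cone K ->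
  (forall w, polar_cone K w -> dotv x w <= 0) -> K x.
Proof.
move=> K0 Kcl Kc xP; have si := @dotv_semi_inner n; have [Kcv KZ] := Kc.
have [Kp pP] := proj_onP x K0 Kcl Kcv.
move: (proj_on K x) Kp pP => p Kp pP.
suff : dotv (x - p) (x - p) <= 0.
  move=> h; have /dotv_eq0/eqP : dotv (x - p) (x - p) = 0.
    by apply/eqP; rewrite eq_le h (si_ge0 si).
  by rewrite subr_eq0 => /eqP ->.
have pol : polar_cone K (x - p).
  by move=> k Kk; have := pP _ (cone_add Kc Kk Kp); rewrite addrK.
have := pP 0 (cone0 K0 Kc); rewrite sub0r (siNr si).
have := xP _ pol; rewrite dotvC [dotv (x - p) (x - p)](siDr si) (siNr si); lra.
Qed.


(** * The largest singular value as an operator norm *)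

(** Cauchy-Schwarz on each row; the constant is the squared Frobenius norm. It serves to make
    suprema finite. *)
Lemma mulmx_bounded m n (A : 'M[R]_(m, n)) :
  exists2 C, 0 <= C & forall x, dotv (A *m x) (A *m x) <= C * dotv x x.
Proof.
have si := @dotv_semi_inner n.
pose a i := (row i A)^T; exists (\sum_i dotv (a i) (a i)) => [|x].
  by apply: sumr_ge0 => i _; exact: si_ge0 si _.
rewrite {1}/dotv mulr_suml; apply: ler_sum => i _.
have -> : (A *m x) i 0 = dotv (a i) x.
  by rewrite mxE; apply: eq_bigr => j _; rewrite !mxE.
by rewrite -expr2; exact: si_cauchy_schwarz si _ _.
Qed.

Lemma gram_eigenvalue m n (A : 'M[R]_(m, n)) l :
  eigenvalue (A^T *m A) l ->
  exists2 x : 'cV[R]_n, 0 < dotv x x & dotv (A *m x) (A *m x) = l * dotv x x.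
Proof.
move=> /eigenvalueP[v vA v0]; exists v^T.
  rewrite lt_def (si_ge0 (@dotv_semi_inner n)) andbT.
  by apply: contra v0 => /eqP/dotv_eq0/(congr1 trmx); rewrite trmxK trmx0 => ->.
have -> : dotv (A *m v^T) (A *m v^T) = dotv v^T (v *m (A^T *m A))^T.
  by rewrite dotv_mulmx !trmx_mul trmxK mulmxA.
by rewrite vA linearZ /= (siZr (@dotv_semi_inner n)).
Qed.

Let sigma_set m n (A : 'M[R]_(m, n)) :=
  [set Num.sqrt l | l in [set l : R | eigenvalue (A^T *m A) l]].

Let sigma_ubound m n (A : 'M[R]_(m, n)) : has_ubound (sigma_set A).
Proof.
have [C C0 AC] := mulmx_bounded A; exists (Num.sqrt C) => _ [l /= Al <-].
have [x x0 Ax] := gram_eigenvalue Al.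
by rewrite ler_sqrt // -(ler_pM2r x0) -Ax.
Qed.

Lemma sigma_max_ge0 m n (A : 'M[R]_(m, n)) : 0 <= sigma_max A.
Proof.
have [[_ [l Al _]]|e0] := pselect (sigma_set A !=set0); last first.
  (* An empty set of singular values gives the default [sup set0 = 0]. *)
  rewrite /sigma_max (_ : [set _ | _ in _] = set0) ?sup0 //.
  by apply/eqP; apply: contra_notT e0 => /set0P.
apply: le_trans (sqrtr_ge0 l) _; apply: ub_le_sup; first exact: sigma_ubound.
by exists l.
Qed.

(* The supremum [l] of the Rayleigh quotient is an eigenvalue of [A^T A]: the
   form [Q = l |x|^2 - |A x|^2] is nonnegative, and if its matrix [M] were
   invertible then Cauchy-Schwarz for [Q] applied to [x] and [M x] would make
   [Q] coercive, so that [l] could be decreased. *)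
Lemma sigma_maxP m n (A : 'M[R]_(m, n)) (x : 'cV[R]_n) :
  dotv (A *m x) (A *m x) <= sigma_max A ^+ 2 * dotv x x.
Proof.
have si := @dotv_semi_inner n; have si_m := @dotv_semi_inner m.
have [x0|x0] := eqVneq (dotv x x) 0.
  by rewrite x0 (dotv_eq0 x0) mulmx0 (si0l si_m) mulr0.
have unit y : dotv y y != 0 ->
    dotv ((snorm (@dotv R n) y)^-1 *: y) ((snorm (@dotv R n) y)^-1 *: y) = 1.
  move=> y0; rewrite (siZl si) (siZr si) mulrA -invfM -expr2 (sqr_snorm si).
  by rewrite mulVf.
pose E := [set dotv (A *m y) (A *m y) | y in [set y : 'cV[R]_n | dotv y y = 1]].
have [C C0 AC] := mulmx_bounded A.
have supE : has_sup E.
  split; first by eexists; eexists; [exact: unit x0 | reflexivity].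
  by exists C => _ [y /= y1 <-]; rewrite (le_trans (AC y)) // y1 mulr1.
pose l := sup E.
have rayleigh y : dotv (A *m y) (A *m y) <= l * dotv y y.
  have [y0|y0] := eqVneq (dotv y y) 0.
    by rewrite y0 (dotv_eq0 y0) mulmx0 (si0l si_m) mulr0.
  have : E (dotv (A *m ((snorm (@dotv R n) y)^-1 *: y))
              (A *m ((snorm (@dotv R n) y)^-1 *: y))).
    by eexists; [exact: unit y0 | reflexivity].
  move=> /(ub_le_sup (proj2 supE)); rewrite -scalemxAr (siZl si_m) (siZr si_m).
  rewrite mulrA -invfM -expr2 (sqr_snorm si) mulrC ler_pdivrMr //.
  by rewrite lt_def y0 (si_ge0 si).
have l0 : 0 <= l.
  have := le_trans (si_ge0 si_m _) (rayleigh x).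
  by rewrite pmulr_lge0 // lt_def x0 (si_ge0 si).
pose M := l%:M - A^T *m A.
pose Q y u := dotv (M *m y) u.
have QE y u : Q y u = l * dotv y u - dotv (A *m y) (A *m u).
  rewrite /Q mulmxBl mul_scalar_mx (siDl si) (siZl si) (siNl si) -mulmxA.
  by rewrite [dotv (A *m y) _]dotvC dotv_mulmx [dotv u _]dotvC.
have siQ : semi_inner Q.
  split=> [y u|y u v|a y u|y].
  - by rewrite !QE dotvC [dotv (A *m y) _]dotvC.
  - by rewrite /Q mulmxDr (siDl si).
  - by rewrite /Q -scalemxAr (siZl si).
  - by rewrite QE subr_ge0.
have eig : eigenvalue (A^T *m A) l.
  have [Mu|Mn] := boolP (M \in unitmx); last first.
    rewrite /eigenvalue /eigenspace kermx_eq0 -(opprB l%:M) /row_free mxrank_opp.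
    by move: Mn; rewrite -row_free_unit.
  have [C' C'0 MC] := mulmx_bounded (invmx M).
  have coercive y : dotv y y <= C' * l * Q y y.
    have -> : dotv y y = dotv (invmx M *m (M *m y)) (invmx M *m (M *m y)).
      by rewrite mulmxA mulVmx // mul1mx.
    apply: le_trans (MC _) _; rewrite -mulrA ler_wpM2l //.
    have := si_cauchy_schwarz siQ y (M *m y).
    rewrite {1}/Q (QE (M *m y)).
    have := si_ge0 si_m (A *m (M *m y)); have := si_ge0 siQ y.
    have := si_ge0 si (M *m y).
    have [->|r0] := eqVneq (dotv (M *m y) (M *m y)) 0.
      by move=> _ Q0 _ _; rewrite mulr_ge0.
    move: (dotv (M *m y) (M *m y)) (Q y y) (dotv (A *m _) _) r0.
    move=> r t a r0 r_ge0 t0 a0 h.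
    have r_gt0 : 0 < r by rewrite lt_def r0.
    rewrite -(ler_pM2r r_gt0) -expr2; apply: le_trans h _.
    by rewrite [l * t]mulrC -mulrA ler_wpM2l // gerBl.
  pose K := C' * l; have K0 : 0 <= K by rewrite mulr_ge0.
  have K_gt0 : 0 < K.
    rewrite lt_def K0 andbT; apply: contraNneq x0 => K00.
    have := coercive x; rewrite -/K K00 mul0r => h.
    by rewrite eq_le h (si_ge0 si).
  suff : l <= l - K^-1.
    by rewrite lerBrDr gerDl leNgt invr_gt0 K_gt0.
  apply: ge_sup; first by case: supE.
  move=> _ [y /= y1 <-]; have := coercive y; rewrite QE y1 mulr1 -/K.
  rewrite mulrC -ler_pdivrMr // mul1r; lra.
apply: le_trans (rayleigh x) _; rewrite ler_wpM2r ?(si_ge0 si) //.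
rewrite -(sqr_sqrtr l0) ler_pXn2r ?nnegrE ?sqrtr_ge0 ?sigma_max_ge0 //.
by apply: ub_le_sup; [exact: sigma_ubound | exists l].
Qed.

Lemma sigma_max_quadratic n (P : 'M[R]_n) (x : 'cV[R]_n) :
  dotv (P *m x) x <= sigma_max P * dotv x x.
Proof.
have si := @dotv_semi_inner n.
apply: le_trans (si_le_snorm si _ _) _.
rewrite -(sqr_snorm si) expr2 mulrA ler_wpM2r ?snorm_ge0 //.
rewrite -(@ler_pXn2r _ 2) ?nnegrE ?mulr_ge0 ?snorm_ge0 ?sigma_max_ge0 //.
by rewrite exprMn !(sqr_snorm si) sigma_maxP.
Qed.

End Euclid.

(** * The metric of the primal-dual iteration *)

Section PrimalDualMetric.
Variables (R : realType) (n m : nat) (P : 'M[R]_n) (H : 'M[R]_(m, n)).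
Variables (alpha beta : R).

(** The form of the block matrix with rows [(alpha^-1 I - P, - H^T)] and [(- H, beta^-1 I)]. *)
Definition pd_form (p p' : 'cV[R]_n * 'cV[R]_m) : R :=
  alpha^-1 * dotv p.1 p'.1 - dotv (P *m p.1) p'.1
  - dotv (H *m p.1) p'.2 - dotv (H *m p'.1) p.2 + beta^-1 * dotv p.2 p'.2.

Hypotheses (P_sym : symmetric_mx P) (alpha_gt0 : 0 < alpha) (beta_gt0 : 0 < beta).
Hypothesis step_size : alpha * (sigma_max P + beta * sigma_max H ^+ 2) < 1.

Let gap := alpha^-1 - (sigma_max P + beta * sigma_max H ^+ 2).

Let gap_gt0 : 0 < gap.
Proof. by rewrite subr_gt0 -[_^-1]mul1r ltr_pdivlMr // mulrC. Qed.

(** Complete the square in [y]; what remains, [|x|^2 / alpha - <P x, x> - beta |H x|^2], is at least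
    [gap |x|^2]. *)
Let pd_form_lower (x : 'cV[R]_n) (y : 'cV[R]_m) :
  gap * dotv x x + beta^-1 * dotv (y - beta *: (H *m x)) (y - beta *: (H *m x))
  <= pd_form (x, y) (x, y).
Proof.
rewrite /pd_form (si_sqrB (@dotv_semi_inner R m)) !(dotvE R m) /= /gap.
rewrite (dotvC y (H *m x)).
have Px := sigma_max_quadratic P x.
have Hx := sigma_maxP H x; rewrite -(ler_pM2l beta_gt0) in Hx.
have -> : beta^-1 * (dotv y y - 2 * (beta * dotv (H *m x) y) +
    beta * (beta * dotv (H *m x) (H *m x))) = beta^-1 * dotv y y
    - 2 * dotv (H *m x) y + beta * dotv (H *m x) (H *m x).
  by field; rewrite gt_eqF.
move: Px Hx; lra.
Qed.

Lemma pd_form_semi_inner : semi_inner pd_form.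
Proof.
have si_n := @dotv_semi_inner R n; have si_m := @dotv_semi_inner R m.
split=> [[x y] [x' y']|[x y] [x' y'] [u v]|a [x y] [x' y']|[x y]];
  rewrite ?/pd_form /=.
- have -> : dotv (P *m x) x' = dotv (P *m x') x by rewrite dotv_mulmx P_sym dotvC.
  rewrite (dotvC x) (dotvC y); ring.
- rewrite !mulmxDr !(siE si_n) !(siE si_m); ring.
- rewrite -!scalemxAr !(siE si_n) !(siE si_m); ring.
apply: le_trans (pd_form_lower x y).
rewrite addr_ge0 // mulr_ge0 ?invr_ge0 ?(ltW gap_gt0) ?(ltW beta_gt0) //;
  exact: si_ge0.
Qed.

(** This turns Cauchy estimates in the metric into Cauchy estimates for both components. *)
Lemma pd_form_coercive : exists2 C, 0 < C & forall p,
  dotv p.1 p.1 + dotv p.2 p.2 <= C * pd_form p p.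
Proof.
have si_n := @dotv_semi_inner R n; have si_m := @dotv_semi_inner R m.
pose s := sigma_max H ^+ 2; have s0 : 0 <= s by rewrite sqr_ge0.
(* With [N] the form at [(x, y)] and [t = y - beta H x]: [|x|^2 <= N / gap], [|t|^2 <= beta N] and
   [|y|^2 <= 2 |t|^2 + 2 beta^2 s |x|^2]. *)
exists ((1 + 2 * beta ^+ 2 * s) / gap + 2 * beta) => [|[x y] /=].
  have := divr_ge0 (mulr_ge0 (mulr_ge0 (ler0n R 2) (sqr_ge0 beta)) s0) (ltW gap_gt0).
  have := beta_gt0; have : 0 < gap^-1 by rewrite invr_gt0.
  rewrite mulrDl mul1r; lra.
have low := pd_form_lower x y.
have Hx := sigma_maxP H x; rewrite -/s in Hx.
set t := y - beta *: (H *m x) in low.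
have tt := si_ge0 si_m t; have xx := si_ge0 si_n x.
have yE : y = t + beta *: (H *m x) by rewrite subrK.
have yy : dotv y y <= 2 * dotv t t + 2 * (beta ^+ 2 * dotv (H *m x) (H *m x)).
  have := si_ge0 si_m (t - beta *: (H *m x)).
  rewrite yE; move: (t) => t'; rewrite (si_sqrB si_m t').
  rewrite !(siDl si_m) !(siDr si_m) !(siZl si_m, siZr si_m) (dotvC (H *m x) t').
  rewrite expr2; lra.
have Nx : gap * dotv x x <= pd_form (x, y) (x, y).
  apply: le_trans low; rewrite lerDl mulr_ge0 // invr_ge0 ltW //.
have Nt : beta^-1 * dotv t t <= pd_form (x, y) (x, y).
  by apply: le_trans low; rewrite lerDr mulr_ge0 // ltW.
move: (pd_form _ _) Nx Nt => N.
rewrite -ler_pdivlMl // mulrC => Nx.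
rewrite -ler_pdivlMl ?invr_gt0 // invrK => Nt.
have b2 := sqr_ge0 beta.
have : beta ^+ 2 * dotv (H *m x) (H *m x) <= beta ^+ 2 * s * dotv x x.
  by rewrite -mulrA ler_wpM2l.
have : (1 + 2 * beta ^+ 2 * s) * dotv x x <= (1 + 2 * beta ^+ 2 * s) * (N / gap).
  by rewrite ler_wpM2l //; move: (mulr_ge0 b2 s0); lra.
have -> : ((1 + 2 * beta ^+ 2 * s) / gap + 2 * beta) * N =
    (1 + 2 * beta ^+ 2 * s) * (N / gap) + 2 * (beta * N) by ring.
move: (N / gap) => r; lra.
Qed.

End PrimalDualMetric.

(** * Limits of means, recession directions and distances *)

Section Limits.
Variable R : realType.

Lemma cvgn_dotv n (u v : nat -> 'cV[R]_n) (a b : 'cV[R]_n) :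
  u @ \oo --> a -> v @ \oo --> b -> (fun j => dotv (u j) (v j)) @ \oo --> dotv a b.
Proof. exact: cvg_dotv. Qed.

Lemma cvgn_cst (U : topologicalType) (a : U) : (fun _ : nat => a) @ \oo --> a.
Proof. exact: cvg_cst. Qed.

Lemma cvgn_ler (u v : nat -> R) (a b : R) :
  u @ \oo --> a -> v @ \oo --> b -> (forall j, u j <= v j) -> a <= b.
Proof. by move=> ua vb uv; apply: ler_cvg_to ua vb _; exact: nearW. Qed.

(** Cesaro means of the increments telescope to [(x_(j+1) - x_0) / (j + 1)]. *)
Lemma mean_increment_cvg n (x : nat -> 'cV[R]_n) (l : 'cV[R]_n) :
  (fun j => x j.+1 - x j) @ \oo --> l ->
  (fun j => j.+1%:R^-1 *: x j.+1) @ \oo --> l.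
Proof.
move=> /cvg_colP xl; apply/cvg_colP => i.
have := cesaro (xl i); rewrite /arithmetic_mean => mean.
have x0 : (fun j => j.+1%:R^-1 * x 0%N i 0) @ \oo --> (0 : R).
  rewrite -[X in _ --> X](mul0r (x 0%N i 0)); apply: cvgM; last exact: cvg_cst.
  exact: cvg_harmonic.
rewrite -[l i 0]addr0; apply: cvg_trans (cvgD mean x0).
apply: near_eq_cvg; apply: nearW => j /=.
rewrite mxE -mulrDr; congr (_ * _).
rewrite -[LHS]/(series _ _ + x 0%N i 0).
rewrite (_ : series _ _ = \sum_(0 <= k < j.+1) (x k.+1 i 0 - x k i 0)).
  by rewrite telescope_sumr // subrK.
by rewrite /series /=; apply: eq_bigr => k _; rewrite !mxE.
Qed.

Lemma cvg_harmonicZ n (u : nat -> 'cV[R]_n) (l : 'cV[R]_n) :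
  u @ \oo --> l -> (fun j => j.+1%:R^-1 *: u j.+1) @ \oo --> (0 : 'cV[R]_n).
Proof.
move=> ul; rewrite -(scale0r l); apply: cvgZ; first exact: cvg_harmonic.
by rewrite (cvg_shiftS u).
Qed.

(** For [a] in [D], the points [a + (x_j - a) / j] of the segment from [a] to [x_j] tend to
    [a + l]. *)
Lemma rec_cone_limit n (D : set 'cV[R]_n) (x : nat -> 'cV[R]_n) (l : 'cV[R]_n) :
  closed D -> convex_set D -> (forall j, D (x j)) ->
  (fun j => j.+1%:R^-1 *: x j.+1) @ \oo --> l -> rec_cone D l.
Proof.
move=> Dcl Dcv Dx xl a Da.
apply: (@closed_seq R n D (fun j => a + j.+1%:R^-1 *: (x j.+1 - a))) => //.
  move=> j; apply: convexP => //; rewrite ?invr_ge0 //.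
  by rewrite invf_le1 // ler1n.
rewrite addrC -[l in X in _ --> X]subr0; apply: cvgD; first exact: cvg_cst.
under eq_fun do rewrite scalerBr; apply: cvgB => //.
by apply: (@cvg_harmonicZ n (fun=> a) a); exact: cvg_cst.
Qed.

Lemma dist_to_cvg0 n (D : nat -> set 'cV[R]_n) (x y : nat -> 'cV[R]_n) :
  (forall j, D j (y j)) -> (fun j => x j - y j) @ \oo --> (0 : 'cV[R]_n) ->
  (fun j => dist_to (x j) (D j)) @ \oo --> (0 : R).
Proof.
move=> Dy xy.
have nrm : (fun j => l2norm (x j - y j)) @ \oo --> (0 : R).
  rewrite -(sqrtr0 R) -[X in Num.sqrt X](si0l (@dotv_semi_inner R n) 0).
  apply: (cvg_comp _ Num.sqrt (cvgn_dotv xy xy)).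
  exact: sqrt_continuous.
apply: squeeze_cvgr (cvg_cst 0) nrm; apply: nearW => j; apply/andP; split.
  apply: lb_le_inf => [|_ [u _ <-]]; last exact: sqrtr_ge0.
  by exists (l2norm (x j - y j)), (y j).
by apply: ge_inf; [exists 0 => _ [u _ <-]; exact: sqrtr_ge0 | exists (y j)].
Qed.

End Limits.
Arguments cvgn_cst {U} a.

(** * Relaxed steps *)

(** Here [s] and [p] stand for differences of two points and of their images. With [r = s - p] the
    hypothesis reads [<s, r> >= |r|^2], whence [|s - rho r|^2 <= |s|^2 - rho (2 - rho) |r|^2]. *)
Lemma relaxed_firmly_nonexpansive (R : realType) (V : lmodType R)
    (B : V -> V -> R) (rho : R) (s p : V) :
  semi_inner B -> 0 < rho -> 0 <= B p (s - p) ->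
  B (s + rho *: (p - s)) (s + rho *: (p - s)) <=
  B s s - (2 - rho) / rho * B (rho *: (p - s)) (rho *: (p - s)).
Proof.
move=> siB rho_gt0; rewrite -(opprB s p).
have -> : B p (s - p) = B s (s - p) - B (s - p) (s - p).
  by rewrite -(siNl siB) -(siDl siB) subKr.
move: (s - p) => r h; rewrite scalerN (si_sqrB siB) !(siE siB) ?(mulrN, opprK).
have -> : (2 - rho) / rho * (rho * (rho * B r r)) =
  (2 - rho) * rho * B r r by field; rewrite gt_eqF.
nra.
Qed.

Section RelaxedSequence.
Variables (R : realType) (n : nat) (x z : nat -> 'cV[R]_n) (l : 'cV[R]_n) (rho : R).
Hypothesis rho_gt0 : 0 < rho.
Hypothesis x_rec : forall j, x j.+1 = x j + rho *: (z j - x j).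
Hypothesis xl : (fun j => x j.+1 - x j) @ \oo --> l.

Lemma relaxed_gap_cvg : (fun j => z j - x j) @ \oo --> rho^-1 *: l.
Proof.
have -> : (fun j => z j - x j) = (fun j => rho^-1 *: (x j.+1 - x j)).
  apply/funext => j.
  by rewrite x_rec [x j + _]addrC addrK scalerA mulVf ?gt_eqF // scale1r.
by apply: cvgZ => //; exact: cvg_cst.
Qed.

(** A step of [z] is a step of [x] plus the difference of two consecutive gaps [z - x], which tends
    to 0. *)
Lemma relaxed_step_cvg : (fun j => z j.+1 - z j) @ \oo --> l.
Proof.
have gap := relaxed_gap_cvg.
have gapS : (fun j => z j.+1 - x j.+1) @ \oo --> rho^-1 *: l.
  by rewrite (cvg_shiftS (fun j => z j - x j)).
have -> : (fun j => z j.+1 - z j) =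
    (fun j => (x j.+1 - x j) + ((z j.+1 - x j.+1) - (z j - x j))).
  by apply/funext => j; apply/colP => i; rewrite !mxE; ring.
rewrite -[l in _ --> l]addr0 -[X in l + X](subrr (rho^-1 *: l)).
by apply: cvgD => //; exact: cvgB.
Qed.

End RelaxedSequence.

(** * The primal-dual iteration as an averaged orbit *)

Section PrimalDualIteration.
Variables (R : realType) (n m : nat).
Variables (P : 'M[R]_n) (q : 'cV[R]_n) (H : 'M[R]_(m, n)) (g : 'cV[R]_m).
Variables (D : set 'cV[R]_n) (K : set 'cV[R]_m) (alpha beta rho : R).
Hypotheses (P_sym : symmetric_mx P) (P_psd : psd_mx P).
Hypotheses (D_neq0 : D !=set0) (D_closed : closed D) (D_convex : convex_set D).
Hypotheses (K_neq0 : K !=set0) (K_closed : closed K) (K_cone : convex_cone K).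
Hypotheses (alpha_gt0 : 0 < alpha) (beta_gt0 : 0 < beta) (rho_gt0 : 0 < rho).

(** The projected point minus its projection, divided by [alpha]; [dual_residual] is the analogue
    with [beta]. *)
Definition primal_residual (x z : 'cV[R]_n) (y : 'cV[R]_m) : 'cV[R]_n :=
  alpha^-1 *: (x - z) - (P *m x + q + H^T *m y).

Definition dual_residual (x z : 'cV[R]_n) (y w : 'cV[R]_m) : 'cV[R]_m :=
  beta^-1 *: (y - w) + (H *m (2 *: z - x) - g).

Lemma primal_step x z y : z = proj_on D (x - alpha *: (P *m x + q + H^T *m y)) ->
  D z /\ normal_cone D z (primal_residual x z y).
Proof.
move=> zE; have [] := proj_onP (x - alpha *: (P *m x + q + H^T *m y))
  D_neq0 D_closed D_convex.
rewrite -zE => Dz zP; split=> // a Da.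
rewrite -(pmulr_rle0 _ alpha_gt0) -(siZl (@dotv_semi_inner R n)).
rewrite /primal_residual scalerBr scalerA divff ?gt_eqF // scale1r addrAC.
exact: zP.
Qed.

(** The projection inequality tested at [w + v], for [v] polar, puts the residual in the bipolar
    cone, that is in [K]; tested at [0] and [2 w] it gives orthogonality. *)
Lemma dual_step x z y w :
  w = proj_on (polar_cone K) (y + beta *: (H *m (2 *: z - x) - g)) ->
  [/\ polar_cone K w, K (dual_residual x z y w) &
      dotv (dual_residual x z y w) w = 0].
Proof.
move=> wE; have si_m := @dotv_semi_inner R m.
have pol_cone := @polar_cone_polar R m K.
have pol0 : polar_cone K 0 by move=> k _; rewrite (si0l si_m).
have [] := proj_onP (y + beta *: (H *m (2 *: z - x) - g))
  (ex_intro _ _ pol0) (@polar_closed R m K) (@polar_convex R m K).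
rewrite -wE => Kw wP.
have {}wP v : polar_cone K v -> dotv (dual_residual x z y w) (v - w) <= 0.
  move=> Kv; rewrite -(pmulr_rle0 _ beta_gt0) -(siZl si_m).
  rewrite /dual_residual scalerDr scalerA divff ?gt_eqF // scale1r addrAC.
  exact: wP.
split=> //.
  apply: bipolar => // v Kv.
  by have := wP _ (cone_add pol_cone Kw Kv); rewrite addrC addKr.
have := wP _ pol0; rewrite sub0r (siNr si_m) oppr_le0 => h.
apply/eqP; rewrite eq_le h andbT.
have [_ polZ] := pol_cone.
have := wP _ (polZ 2 w (ler0n _ _) Kw).
by rewrite scaler_nat mulr2n addrK.
Qed.

Variables (X Z : nat -> 'cV[R]_n) (Y W : nat -> 'cV[R]_m).
Let y_ j := primal_residual (X j) (Z j) (Y j).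
Let u_ j := dual_residual (X j) (Z j) (Y j) (W j).
Hypothesis ZD : forall j, D (Z j).
Hypothesis yN : forall j, normal_cone D (Z j) (y_ j).
Hypothesis WK : forall j, polar_cone K (W j).
Hypothesis uK : forall j, K (u_ j).
Hypothesis uW : forall j, dotv (u_ j) (W j) = 0.
Hypothesis X_rec : forall j, X j.+1 = X j + rho *: (Z j - X j).
Hypothesis Y_rec : forall j, Y j.+1 = Y j + rho *: (W j - Y j).
Hypothesis rho_lt2 : rho < 2.
Hypothesis step_size : alpha * (sigma_max P + beta * sigma_max H ^+ 2) < 1.

Let si_n := @dotv_semi_inner R n.
Let si_m := @dotv_semi_inner R m.
Local Notation form := (pd_form P H alpha beta).

(** The normal cone inclusions are monotone. The sum of their two monotonicity products, plus
    [<P (Z j - Z k), Z j - Z k> >= 0], is exactly this value of the form. *)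
Lemma iteration_firm j k :
  0 <= form (Z j - Z k, W j - W k)
    ((X j - X k, Y j - Y k) - (Z j - Z k, W j - W k)).
Proof.
have h1 : 0 <= dotv (y_ j - y_ k) (Z j - Z k).
  have := yN j (ZD k); have := yN k (ZD j); rewrite -(opprB (Z j) (Z k)).
  move: (Z j - Z k) (y_ j) (y_ k) => dz a b; rewrite !(dotvE R n); lra.
have h2 : 0 <= dotv (u_ j - u_ k) (W j - W k).
  have := WK k (uK j); have := WK j (uK k).
  rewrite (dotvC (W k)) (dotvC (W j)); have := uW k; have := uW j.
  move: (u_ j) (u_ k) (W j) (W k) => a b c d; rewrite !(dotvE R m); lra.
(* The residuals are affine; adding [q], and [g] below, cancels their constant terms. *)
have dy : y_ j - y_ k = primal_residual (X j - X k) (Z j - Z k) (Y j - Y k) + q.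
  rewrite /y_ /primal_residual !mulmxBr.
  by apply/colP => i; rewrite !mxE; ring.
have du : u_ j - u_ k =
    dual_residual (X j - X k) (Z j - Z k) (Y j - Y k) (W j - W k) + g.
  rewrite /u_ /dual_residual !mulmxBr -!scalemxAr !mulmxBr.
  by apply/colP => i; rewrite !mxE; ring.
move: h1 h2; rewrite dy du.
move: (X j - X k) (Z j - Z k) (Y j - Y k) (W j - W k) => x z y w.
have -> : primal_residual x z y + q = alpha^-1 *: (x - z) - P *m x - H^T *m y.
  by apply/colP => i; rewrite !mxE; ring.
have -> : dual_residual x z y w + g =
    beta^-1 *: (y - w) + (2 *: (H *m z) - H *m x).
  by rewrite /dual_residual addrA subrK mulmxBr -scalemxAr.
rewrite !(dotvE R n) !(dotvE R m) => h1 h2.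
rewrite /pd_form /= !mulmxBr !(dotvE R n) !(dotvE R m).
have Pz : 0 <= dotv (P *m z) z by rewrite dotvC.
have HY : dotv (H^T *m y) z = dotv (H *m z) y.
  by rewrite dotv_mulmx trmxK dotvC.
have PC : dotv (P *m x) z = dotv (P *m z) x by rewrite dotv_mulmx P_sym dotvC.
rewrite HY PC in h1.
rewrite (dotvC z x) (dotvC w y); lra.
Qed.

(** The pairs [(X j, Y j)] form an averaged orbit with constant [(2 - rho) / rho]; coercivity then
    separates the components. *)
Lemma iteration_steps_cvg : exists (zbar : 'cV[R]_n) (wbar : 'cV[R]_m),
  (fun j => X j.+1 - X j) @ \oo --> zbar /\ (fun j => Y j.+1 - Y j) @ \oo --> wbar.
Proof.
have siB := pd_form_semi_inner P_sym alpha_gt0 beta_gt0 step_size.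
have [C C_gt0 coercive] := pd_form_coercive alpha_gt0 beta_gt0 step_size.
pose s j : 'cV[R]_n * 'cV[R]_m := (X j, Y j).
have s_rec j : s j.+1 = s j + rho *: ((Z j, W j) - s j).
  by rewrite /s X_rec Y_rec.
have c_gt0 : 0 < (2 - rho) / rho by rewrite divr_gt0 // subr_gt0.
have averaged j k : form (s j.+1 - s k.+1) (s j.+1 - s k.+1) <=
    form (s j - s k) (s j - s k) - (2 - rho) / rho *
    form (s j.+1 - s j - (s k.+1 - s k)) (s j.+1 - s j - (s k.+1 - s k)).
  have := relaxed_firmly_nonexpansive siB rho_gt0 (iteration_firm j k).
  have dE i : s i.+1 - s i = rho *: ((Z i, W i) - s i) by rewrite s_rec addrC addKr.
  rewrite !dE -scalerBr !s_rec.
  have -> : (Z j - Z k, W j - W k) - (X j - X k, Y j - Y k) =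
      (Z j, W j) - s j - ((Z k, W k) - s k).
    by apply: injective_projections => /=; apply/colP => i; rewrite !mxE; ring.
  have -> : s j + rho *: ((Z j, W j) - s j) - (s k + rho *: ((Z k, W k) - s k)) =
      (X j - X k, Y j - Y k) + rho *: ((Z j, W j) - s j - ((Z k, W k) - s k)).
    by apply: injective_projections => /=; apply/colP => i; rewrite !mxE; ring.
  by [].
have cauchy e : 0 < e -> exists J, forall i l, (J <= i)%N -> (J <= l)%N ->
    dotv (X i.+1 - X i - (X l.+1 - X l)) (X i.+1 - X i - (X l.+1 - X l)) +
    dotv (Y i.+1 - Y i - (Y l.+1 - Y l)) (Y i.+1 - Y i - (Y l.+1 - Y l)) <= e.
  move=> e_gt0; have [J sJ] := step_cauchy siB c_gt0 averaged (divr_gt0 e_gt0 C_gt0).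
  exists J => i l Ji Jl; apply: le_trans (coercive (s i.+1 - s i - (s l.+1 - s l))) _.
  by rewrite -ler_pdivlMl // mulrC sJ.
have [zbar zb] : exists a : 'cV[R]_n, (fun j => X j.+1 - X j) @ \oo --> a.
  apply: cauchy_dotv_cvg => e /cauchy[J eJ]; exists J => i l Ji Jl.
  by apply: le_trans (eJ i l Ji Jl); rewrite lerDl (si_ge0 si_m).
have [wbar wb] : exists a : 'cV[R]_m, (fun j => Y j.+1 - Y j) @ \oo --> a.
  apply: cauchy_dotv_cvg => e /cauchy[J eJ]; exists J => i l Ji Jl.
  by apply: le_trans (eJ i l Ji Jl); rewrite lerDr (si_ge0 si_n).
by exists zbar, wbar.
Qed.

(** * Conditions satisfied by the limits of the steps *)

Section StepLimits.
Variables (zbar : 'cV[R]_n) (wbar : 'cV[R]_m).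
Hypothesis Xbar : (fun j => X j.+1 - X j) @ \oo --> zbar.
Hypothesis Ybar : (fun j => Y j.+1 - Y j) @ \oo --> wbar.

Let gapZ := relaxed_gap_cvg rho_gt0 X_rec Xbar.
Let gapW := relaxed_gap_cvg rho_gt0 Y_rec Ybar.
Let meanZ := mean_increment_cvg (relaxed_step_cvg rho_gt0 X_rec Xbar).
Let meanW := mean_increment_cvg (relaxed_step_cvg rho_gt0 Y_rec Ybar).

(** The convergent parts of the residuals: they involve only the gaps [Z - X] and [W - Y], while the
    remaining terms are linear in [Z] and [W] and may grow like [j]. *)
Let rY j := P *m (Z j - X j) + H^T *m (W j - Y j) - alpha^-1 *: (Z j - X j) - q.
Let rU j := H *m (Z j - X j) - beta^-1 *: (W j - Y j) - g.

Let y_E j : y_ j = rY j - P *m Z j - H^T *m W j.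
Proof.
rewrite /y_ /primal_residual /rY !mulmxBr.
by apply/colP => i; rewrite !mxE; ring.
Qed.

Let u_E j : u_ j = H *m Z j + rU j.
Proof.
rewrite /u_ /dual_residual /rU !mulmxBr -!scalemxAr.
by apply/colP => i; rewrite !mxE; ring.
Qed.

Let RY := P *m (rho^-1 *: zbar) + H^T *m (rho^-1 *: wbar)
  - alpha^-1 *: (rho^-1 *: zbar) - q.
Let RU := H *m (rho^-1 *: zbar) - beta^-1 *: (rho^-1 *: wbar) - g.

Let rY_cvg : rY @ \oo --> RY.
Proof.
apply: cvgB; last exact: cvg_cst.
apply: cvgB; last by apply: cvgZ => //; exact: cvg_cst.
by apply: cvgD; exact: cvg_mulmx.
Qed.

Let rU_cvg : rU @ \oo --> RU.
Proof.
apply: cvgB; last exact: cvg_cst.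
apply: cvgB; last by apply: cvgZ => //; exact: cvg_cst.
exact: cvg_mulmx.
Qed.

Let mean_u : (fun j => j.+1%:R^-1 *: u_ j.+1) @ \oo --> H *m zbar.
Proof.
rewrite -[H *m zbar]addr0.
have -> : (fun j => j.+1%:R^-1 *: u_ j.+1) =
    (fun j => H *m (j.+1%:R^-1 *: Z j.+1) + j.+1%:R^-1 *: rU j.+1).
  by apply/funext => j; rewrite u_E scalerDr scalemxAr.
by apply: cvgD; [exact: cvg_mulmx | exact: cvg_harmonicZ rU_cvg].
Qed.

Let mean_y : (fun j => j.+1%:R^-1 *: y_ j.+1) @ \oo -->
  0 - P *m zbar - H^T *m wbar.
Proof.
have -> : (fun j => j.+1%:R^-1 *: y_ j.+1) =
    (fun j => j.+1%:R^-1 *: rY j.+1 - P *m (j.+1%:R^-1 *: Z j.+1)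
              - H^T *m (j.+1%:R^-1 *: W j.+1)).
  by apply/funext => j; rewrite y_E !scalerBr !scalemxAr.
apply: cvgB; last exact: cvg_mulmx.
by apply: cvgB; [exact: cvg_harmonicZ rY_cvg | exact: cvg_mulmx].
Qed.

Lemma zbar_rec : rec_cone D zbar.
Proof. exact: rec_cone_limit D_closed D_convex ZD meanZ. Qed.

Lemma wbar_polar : polar_cone K wbar.
Proof.
apply: (closed_seq (@polar_closed R m K) _ meanW) => j.
by have [_ polZ] := polar_cone_polar K; apply: polZ; rewrite ?invr_ge0.
Qed.

Lemma Hzbar_K : K (H *m zbar).
Proof.
apply: (closed_seq K_closed _ mean_u) => j.
by have [_ KZ] := K_cone; apply: KZ; rewrite ?invr_ge0.
Qed.

(** Complementarity [<u_j, W_j> = 0] divided by [j^2]. *)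
Let Hzbar_wbar : dotv (H *m zbar) wbar = 0.
Proof.
have uw : (fun=> 0 : R) @ \oo --> dotv (H *m zbar) wbar.
  rewrite (_ : (fun=> 0) = fun j =>
    dotv (j.+1%:R^-1 *: u_ j.+1) (j.+1%:R^-1 *: W j.+1)).
    exact: cvgn_dotv mean_u meanW.
  by apply/funext => j; rewrite (siZl si_m) (siZr si_m) uW !mulr0.
exact: (cvg_unique (@norm_hausdorff _ R) uw (cvg_cst 0)).
Qed.

Let Htwbar_zbar : dotv (H^T *m wbar) zbar = 0.
Proof. by rewrite dotv_mulmx trmxK dotvC Hzbar_wbar. Qed.

(** The normal cone inequality at a fixed [x0], divided by [j^2], gives [<P zbar, zbar> <= 0];
    Cauchy-Schwarz for the form of [P] then annihilates [P zbar]. *)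
Lemma P_zbar : P *m zbar = 0.
Proof.
have [x0 Dx0] := D_neq0.
have h : dotv (P *m zbar) zbar <= 0.
  have x0Z : (fun j => j.+1%:R^-1 *: x0 - j.+1%:R^-1 *: Z j.+1) @ \oo --> 0 - zbar.
    apply: cvgB => //; apply: (@cvg_harmonicZ R n (fun=> x0) x0); exact: cvg_cst.
  have lim := cvgn_dotv mean_y x0Z.
  have := cvgn_ler lim (cvgn_cst (0 : R)).
  rewrite !sub0r (siNr si_n) (siDl si_n) !(siNl si_n) Htwbar_zbar subr0 opprK.
  apply=> j.
  rewrite -scalerBr (siZl si_n) (siZr si_n) !pmulr_rle0 ?invr_gt0 //.
  exact: yN.
have siP : semi_inner (fun x y => dotv (P *m x) y).
  split=> [x y|x y a|a x y|x]; last by rewrite dotvC.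
  - by rewrite dotv_mulmx P_sym dotvC.
  - by rewrite mulmxDr (siDl si_n).
  - by rewrite -scalemxAr (siZl si_n).
have z0 : dotv (P *m zbar) zbar = 0.
  by apply/eqP; rewrite eq_le h (si_ge0 siP).
have := si_cauchy_schwarz siP zbar (P *m zbar); rewrite z0 mul0r => h2.
apply: dotv_eq0; apply/eqP; rewrite -sqrf_eq0 eq_le h2 sqr_ge0 //.
Qed.

Let wbar_sq := (rho * beta)^-1 * dotv wbar wbar.
Let zbar_sq := (rho * alpha)^-1 * dotv zbar zbar.

Let RU_wbar : dotv RU wbar = - wbar_sq - dotv g wbar.
Proof.
rewrite /RU /wbar_sq -scalemxAr !(dotvE R m) Hzbar_wbar invfM; ring.
Qed.

Let RY_zbar : dotv RY zbar = - zbar_sq - dotv q zbar.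
Proof.
rewrite /RY /zbar_sq -!scalemxAr P_zbar !(dotvE R n) (si0l si_n) Htwbar_zbar invfM.
ring.
Qed.

(** Start from [<y_j, x> <= <y_j, Z_j>], replace [<H Z_j, W_j>] by [- <rU_j, W_j>] through
    complementarity, drop [- <P Z_j, Z_j>], divide by [j] and pass to the limit. *)
Let primal_bound x : D x ->
  zbar_sq + dotv q zbar + wbar_sq <= dotv (H *m x - g) wbar.
Proof.
move=> Dx.
have lim1 := cvgn_dotv mean_y (cvgn_cst x).
have rUS : (fun j => rU j.+1) @ \oo --> RU by rewrite (cvg_shiftS rU).
have rYS : (fun j => rY j.+1) @ \oo --> RY by rewrite (cvg_shiftS rY).
have lim2 : (fun j => dotv (rU j.+1) (j.+1%:R^-1 *: W j.+1) +
    dotv (rY j.+1) (j.+1%:R^-1 *: Z j.+1)) @ \oo --> dotv RU wbar + dotv RY zbar.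
  by apply: cvgD; exact: cvgn_dotv.
have := cvgn_ler lim1 lim2.
rewrite RU_wbar RY_zbar P_zbar subr0 sub0r (siNl si_n) dotv_mulmx trmxK.
rewrite (siDl si_m) (siNl si_m) [dotv (H *m x) wbar]dotvC.
suff h : forall j, dotv (j.+1%:R^-1 *: y_ j.+1) x <=
  dotv (rU j.+1) (j.+1%:R^-1 *: W j.+1) + dotv (rY j.+1) (j.+1%:R^-1 *: Z j.+1).
  by move=> /(_ h); lra.
move=> j; rewrite (siZl si_n) (siZr si_m) (siZr si_n) -mulrDr.
rewrite ler_wpM2l ?invr_ge0 //.
have := yN j.+1 Dx; rewrite (siDr si_n) (siNr si_n) subr_le0.
move=> /le_trans; apply.
have := uW j.+1; rewrite u_E y_E (siDl si_m); move: (rY j.+1) => r.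
rewrite !(siDl si_n) !(siNl si_n).
have := P_psd (Z j.+1); rewrite [dotv _ (P *m _)]dotvC.
have -> : dotv (H^T *m W j.+1) (Z j.+1) = dotv (H *m Z j.+1) (W j.+1).
  by rewrite dotv_mulmx trmxK dotvC.
lra.
Qed.

(** As [zbar] is a recession direction, [<y_j, zbar> <= 0]; with [P zbar = 0] and
    [<W_j, H zbar> <= 0] this leaves [<rY_j, zbar> <= 0]. *)
Let dual_bound : 0 <= zbar_sq + dotv q zbar.
Proof.
have := cvgn_ler (cvgn_dotv rY_cvg (cvgn_cst zbar)) (cvgn_cst (0 : R)).
rewrite RY_zbar => h; rewrite -oppr_le0 opprD; apply: h => j.
have := yN j (zbar_rec (ZD j)); rewrite addrK y_E.
have -> : dotv (rY j - P *m Z j - H^T *m W j) zbar =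
  dotv (rY j) zbar - dotv (P *m Z j) zbar - dotv (W j) (H *m zbar).
  by move: (rY j) => r; rewrite !(siDl si_n) !(siNl si_n) [X in _ - X]dotv_mulmx trmxK.
have -> : dotv (P *m Z j) zbar = 0 by rewrite dotv_mulmx P_sym P_zbar dotvC (si0l si_n).
have := WK j Hzbar_K; lra.
Qed.

(** A late iterate [Z J] serves: [<u_J, wbar> <= 0] bounds [<H Z_J, wbar>] by [- <rU_J, wbar>],
    whose limit is known. *)
Let upper_bound e : 0 < e -> exists2 x, D x & dotv (H *m x - g) wbar <= wbar_sq + e.
Proof.
move=> e_gt0.
have lim : (fun j => - dotv (rU j) wbar) @ \oo --> - dotv RU wbar.
  by apply: cvgN; exact: cvgn_dotv rU_cvg (cvgn_cst wbar).
have : - dotv RU wbar < - dotv RU wbar + e by rewrite ltrDl.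
move=> /(cvgr_le _ lim)[J _ /(_ J (leqnn J))]; rewrite /= RU_wbar => h.
exists (Z J) => //.
have := wbar_polar (uK J); rewrite u_E dotvC; move: (rU J) h => r.
rewrite !(dotvE R m); lra.
Qed.

(** [primal_bound] at the points of [upper_bound] gives the inequality opposite to [dual_bound]. *)
Lemma q_zbar : dotv q zbar = - ((rho * alpha)^-1 * l2norm zbar ^+ 2).
Proof.
rewrite sqr_l2norm -/zbar_sq; apply/eqP; rewrite -addr_eq0 addrC eq_le dual_bound.
rewrite andbT; apply/ler_addgt0Pr => e /upper_bound[x Dx xe].
have := primal_bound Dx; lra.
Qed.

(** The supremum is 0, attained at [0]. The infimum is bounded below by [primal_bound] with
    [dual_bound], and above by [upper_bound]. *)
Lemma inf_sup_wbar :
  (ereal_inf [set (dotv (H *m x - g) wbar)%:E | x in D]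
   = ereal_sup [set (dotv y wbar)%:E | y in K]
     + ((rho * beta)^-1 * l2norm wbar ^+ 2)%:E)%E.
Proof.
have -> : ereal_sup [set (dotv y wbar)%:E | y in K] = 0%E.
  apply/eqP; rewrite eq_le; apply/andP; split.
    by apply: ge_ereal_sup => _ [y Ky <-]; rewrite lee_fin dotvC; exact: wbar_polar.
  apply: ereal_sup_ubound; exists 0; first exact: cone0.
  by rewrite (si0l si_m).
rewrite add0e sqr_l2norm -/wbar_sq; apply/eqP; rewrite eq_le; apply/andP; split.
  apply/lee_addgt0Pr => e /upper_bound[x Dx xe].
  apply: le_trans (_ : (dotv (H *m x - g) wbar)%:E <= _)%E.
    by apply: ereal_inf_lbound; exists x.
  by rewrite -EFinD lee_fin.
apply: le_ereal_inf_tmp => _ [x Dx <-]; rewrite lee_fin.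
have := primal_bound Dx; have := dual_bound; lra.
Qed.

(** The residuals [u_j] and [y_j] lie in the two normal cones; the vectors to them are
    [- (rU_j + g)] and [- (rY_j + q)], which tend to 0 when both step limits vanish. *)
Lemma residuals_cvg0 : zbar = 0 -> wbar = 0 ->
  (fun j => dist_to (H *m Z j - g) (normal_cone (polar_cone K) (W j)))
    @ \oo --> (0 : R) /\
  (fun j => dist_to (- (P *m Z j) - q - H^T *m W j) (normal_cone D (Z j)))
    @ \oo --> (0 : R).
Proof.
move=> z0 w0; split.
  apply: (dist_to_cvg0 (y := u_)).
    by move=> j w Kw; rewrite (siDr si_m) (siNr si_m) uW subr0 dotvC; exact: Kw.
  have -> : (fun j => H *m Z j - g - u_ j) = (fun j => - (rU j + g)).
    by apply/funext => j; rewrite u_E; apply/colP => i; rewrite !mxE; ring.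
  have <- : - (RU + g) = 0.
    by rewrite /RU z0 w0 !scaler0 mulmx0 subr0 sub0r addNr oppr0.
  by apply: cvgN; apply: cvgD => //; exact: cvg_cst.
apply: (dist_to_cvg0 (y := y_)) => //.
have -> : (fun j => - (P *m Z j) - q - H^T *m W j - y_ j) = (fun j => - (rY j + q)).
  by apply/funext => j; rewrite y_E; apply/colP => i; rewrite !mxE; ring.
have <- : - (RY + q) = 0.
  by rewrite /RY z0 w0 !scaler0 !mulmx0 addr0 subr0 sub0r addNr oppr0.
by apply: cvgN; apply: cvgD => //; exact: cvg_cst.
Qed.

End StepLimits.

End PrimalDualIteration.

(** * Return to the original indexing *)

Theorem theorem1 (R : realType) (n m : nat)
  (P : 'M[R]_n) (q : 'cV[R]_n) (H : 'M[R]_(m, n)) (g : 'cV[R]_m)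
  (D : set 'cV[R]_n) (K : set 'cV[R]_m) (alpha beta rho : R)
  (z xi : nat -> 'cV[R]_n) (w eta : nat -> 'cV[R]_m)
  (P_sym : symmetric_mx P) (P_psd : psd_mx P)
  (D_neq0 : D !=set0) (D_closed : closed D) (D_convex : convex_set D)
  (K_neq0 : K !=set0) (K_closed : closed K) (K_cone : convex_cone K)
  (alpha_gt0 : 0 < alpha) (beta_gt0 : 0 < beta)
  (step_size : alpha * (sigma_max P + beta * sigma_max H ^+ 2) < 1)
  (rho_gt0 : 0 < rho) (rho_lt2 : rho < 2)
  (z_rec : forall j : nat, (1 <= j)%N ->
     z j.+1 = proj_on D (xi j - alpha *: (P *m xi j + q + H^T *m eta j)))
  (w_rec : forall j : nat, (1 <= j)%N ->
     w j.+1 = proj_on (polar_cone K)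
                (eta j + beta *: (H *m (2 *: z j.+1 - xi j) - g)))
  (xi_rec : forall j : nat, (1 <= j)%N ->
     xi j.+1 = (1 - rho) *: xi j + rho *: z j.+1)
  (eta_rec : forall j : nat, (1 <= j)%N ->
     eta j.+1 = (1 - rho) *: eta j + rho *: w j.+1) :
  exists (zbar : 'cV[R]_n) (wbar : 'cV[R]_m),
    rec_cone D zbar /\ polar_cone K wbar /\
    (fun j : nat => z j - z j.-1) @ \oo --> zbar /\
    (fun j : nat => w j - w j.-1) @ \oo --> wbar /\
    (ereal_inf [set (dotv (H *m x - g) wbar)%:E | x in D]
     = ereal_sup [set (dotv y wbar)%:E | y in K]
       + ((rho * beta)^-1 * l2norm wbar ^+ 2)%:E)%E /\
    K (H *m zbar) /\
    P *m zbar = 0 /\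
    dotv q zbar = - ((rho * alpha)^-1 * l2norm zbar ^+ 2) /\
    (l2norm wbar = 0 -> l2norm zbar = 0 ->
       (fun j : nat => dist_to (H *m z j - g) (normal_cone (polar_cone K) (w j)))
         @ \oo --> (0 : R) /\
       (fun j : nat => dist_to (- (P *m z j) - q - H^T *m w j)
                            (normal_cone D (z j)))
         @ \oo --> (0 : R)).
Proof.
(* The recursion starts at index 1 and first defines [z 2] and [w 2], so [Z j] is the projection
   computed from [X j] and [Y j]. *)
pose X j := xi j.+1; pose Z j := z j.+2; pose Y j := eta j.+1; pose W j := w j.+2.
have X_rec j : X j.+1 = X j + rho *: (Z j - X j).
  rewrite /X /Z (xi_rec j.+1) //.
  by rewrite scalerBl scale1r scalerBr addrAC addrA.
have Y_rec j : Y j.+1 = Y j + rho *: (W j - Y j).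
  rewrite /Y /W (eta_rec j.+1) //.
  by rewrite scalerBl scale1r scalerBr addrAC addrA.
have ZP j := primal_step D_neq0 D_closed D_convex alpha_gt0 (z_rec j.+1 isT).
have WP j := dual_step K_neq0 K_closed K_cone beta_gt0 (w_rec j.+1 isT).
have ZD j : D (Z j) by case: (ZP j).
have yN j : normal_cone D (Z j) (primal_residual P q H alpha (X j) (Z j) (Y j)).
  by case: (ZP j).
have WK j : polar_cone K (W j) by case: (WP j).
have uK j : K (dual_residual H g beta (X j) (Z j) (Y j) (W j)) by case: (WP j).
have uW j : dotv (dual_residual H g beta (X j) (Z j) (Y j) (W j)) (W j) = 0.
  by case: (WP j).
have [zbar [wbar [Xbar Ybar]]] := iteration_steps_cvg P_sym P_psd alpha_gt0
  beta_gt0 rho_gt0 ZD yN WK uK uW X_rec Y_rec rho_lt2 step_size.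
exists zbar, wbar; split.
  by move=> x; exact: (zbar_rec D_closed D_convex rho_gt0 ZD X_rec Xbar).
split; first by move=> y; exact: (wbar_polar rho_gt0 WK Y_rec Ybar).
split.
  (* At index [j + 3] the difference is [Z j.+1 - Z j]; the shift skips the unconstrained [z 0] and
     [z 1]. *)
  by rewrite -(cvg_shiftn 3); under eq_fun do rewrite addn3;
    exact: (relaxed_step_cvg rho_gt0 X_rec Xbar).
split.
  by rewrite -(cvg_shiftn 3); under eq_fun do rewrite addn3;
    exact: (relaxed_step_cvg rho_gt0 Y_rec Ybar).
split.
  exact: (inf_sup_wbar P_sym P_psd D_neq0 D_closed D_convex K_neq0 K_closed K_cone
    rho_gt0 ZD yN WK uK uW X_rec Y_rec Xbar Ybar).
split; first exact: (Hzbar_K K_closed K_cone rho_gt0 uK X_rec Y_rec Xbar Ybar).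
split.
  exact: (P_zbar P_sym P_psd D_neq0 rho_gt0 yN uW X_rec Y_rec Xbar Ybar).
split.
  exact: (q_zbar P_sym P_psd D_neq0 D_closed D_convex K_closed K_cone
    rho_gt0 ZD yN WK uK uW X_rec Y_rec Xbar Ybar).
move=> wbar0 zbar0.
have z0 : zbar = 0 by apply: dotv_eq0; rewrite -sqr_l2norm zbar0 expr0n.
have w0 : wbar = 0 by apply: dotv_eq0; rewrite -sqr_l2norm wbar0 expr0n.
have [r1 r2] := residuals_cvg0 rho_gt0 yN uK uW X_rec Y_rec Xbar Ybar z0 w0.
by split; rewrite -(cvg_shiftn 2); under eq_fun do rewrite addn2.
Qed.
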